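(* Let $n\ge 2$ and write $1=(1,0,\dots,0)\in\mathbb{R}^n$. (i) Any full $\mathbb{Z}$-lattice in $\mathbb{R}^n$ of the form $\mathbb{Z}\cdot 1+\mathbb{Z}\tau_1+\cdots+\mathbb{Z}\tau_{n-1}$ (with $\tau_1,\dots,\tau_{n-1}\in\mathbb{R}^n$) can be written as $M(U)$ for some angle set $U=\{\alpha_1,\dots,\alpha_m\}$ of $m$ distinct angles in $\mathbb{R}^n$ including the angle $1$, where $m\ge 2n-1$. (ii) Moreover, if $U$ is any set of angles in $\mathbb{R}^n$ containing $1$ such that $M(U)$ is a full lattice in $\mathbb{R}^n$, then $U$ contains a subset of the form $\{1,\alpha_1,\alpha_1',\dots,\alpha_{n-1},\alpha_{n-1}'\}$, consisting of $2n-1$ distinct angles, where $1,\alpha_1,\alpha_2,\dots,\alpha_{n-1}$ are linearly independent over $\mathbb{R}$.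
   Context: An angle (or direction) in $\mathbb{R}^n$ is a nonzero vector of $\mathbb{R}^n$ considered up to multiplication by nonzero real scalars (equivalently, a point of the unit sphere of $\mathbb{R}^n$ with antipodal points identified). The symbol $1$ denotes the vector $(1,0,\dots,0)$, and also the angle it represents. For $p,q\in\mathbb{R}^n$ and angles $\alpha,\beta$, $[\![p,q]\!]_{\alpha,\beta}$ denotes the unique point $z$ of the form $z=p+r\alpha=q+s\beta$ with $r,s\in\mathbb{R}$, if such a unique point exists; otherwise $[\![p,q]\!]_{\alpha,\beta}$ is undefined (written $\emptyset$) and contributes no point. For a set $U$ of angles containing $1$, put $M_0=\{0,1\}\subset\mathbb{R}^n$ and, for $k\ge1$, let $M_k$ be the set of all defined points $[\![p,q]\!]_{\alpha,\beta}$ with $p,q\in M_{k-1}$ and $\alpha,\beta\in U$. The origami set is $M(U)=\bigcup_{k\ge0}M_k$. A full lattice in $\mathbb{R}^n$ is the $\mathbb{Z}$-span of an $\mathbb{R}$-basis of $\mathbb{R}^n$. *)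

(* Defs.v *)
From HB Require Import structures.
From mathcomp Require Import all_boot all_order all_algebra.
From mathcomp Require Import all_classical all_reals.

Set Implicit Arguments.
Unset Strict Implicit.
Unset Printing Implicit Defensive.

Import Order.TTheory GRing.Theory Num.Theory.

Local Open Scope classical_set_scope.
Local Open Scope ring_scope.
Local Open Scope quotient_scope.

Section Origami.
Variables (R : realType) (n : nat).

Definition vec1 : 'rV[R]_n := \row_(j < n) ((j : nat) == 0)%:R.

Lemma vec1_neq0 (hn : (2 <= n)%N) : vec1 != 0.
Proof.
apply/eqP => /rowP /(_ (Ordinal (ltnW hn))).
by rewrite !mxE /= => /eqP; rewrite oner_eq0.
Qed.

Definition nzvec := {v : 'rV[R]_n | v != 0}.

Definition same_angle (u v : nzvec) : bool :=
  `[< exists2 c : R, c != 0 & val v = c *: val u >].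

Lemma same_angle_refl : reflexive same_angle.
Proof. by move=> u; apply/asboolP; exists 1; rewrite ?oner_eq0 ?scale1r. Qed.

Lemma same_angle_sym : symmetric same_angle.
Proof.
suff sub u v : same_angle u v -> same_angle v u.
  by move=> u v; apply/idP/idP; apply: sub.
move=> /asboolP[c c0 e]; apply/asboolP; exists c^-1; rewrite ?invr_eq0 //.
by rewrite e scalerA mulVf // scale1r.
Qed.

Lemma same_angle_trans : transitive same_angle.
Proof.
move=> v u w /asboolP[c c0 e] /asboolP[d d0 f]; apply/asboolP.
by exists (d * c); rewrite ?mulf_neq0 // f e scalerA.
Qed.

Canonical same_angle_equiv :=
  EquivRel same_angle same_angle_refl same_angle_sym same_angle_trans.

Definition angle := {eq_quot same_angle_equiv}.
HB.instance Definition _ := Choice.on angle.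
HB.instance Definition _ := EqQuotient.on angle.

Definition angle_of (v : 'rV[R]_n) (hv : v != 0) : angle :=
  \pi_angle (exist _ v hv : nzvec).

Definition angle1 (hn : (2 <= n)%N) : angle := angle_of (vec1_neq0 hn).

(* Lines and linear independence do not depend on the representative chosen. *)
Definition dirvec (a : angle) : 'rV[R]_n := val (repr a).

Definition line (p : 'rV[R]_n) (a : angle) : set 'rV[R]_n :=
  [set z | exists r : R, z = p + r *: dirvec a].

(* The partial operation [[p, q]]_(a, b), as a set with at most one element:
   it is empty when the intersection point is undefined. *)
Definition meet_point (p q : 'rV[R]_n) (a b : angle) : set 'rV[R]_n :=
  [set z | unique (line p a `&` line q b) z].

Fixpoint origami_stage (U : set angle) (k : nat) : set 'rV[R]_n :=
  if k is k'.+1 then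
    [set z | exists p q a b,
       [/\ origami_stage U k' p, origami_stage U k' q, U a, U b
         & meet_point p q a b z]]
  else [set 0; vec1].

Definition origami (U : set angle) : set 'rV[R]_n :=
  \bigcup_k origami_stage U k.

Definition zspan (s : seq 'rV[R]_n) : set 'rV[R]_n :=
  [set v | inIntSpan (in_tuple s) v].

Definition full_lattice (L : set 'rV[R]_n) : Prop :=
  exists2 b : seq 'rV[R]_n, basis_of fullv b & L = zspan b.

End Origami.

Arguments vec1 : clear implicits.
Arguments angle : clear implicits.
Arguments angle1 R {n} hn.

(* Main.v *)
(** (i) Write X_0 = 1, X_1, ..., X_{n-1} for the basis of the lattice and take
    the 2n-1 directions 1, X_i and X_i - 1. For any two distinct directions
    a, b among them, some integral linear form kills b and is 1 or -1 at a, so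
    r a - s b in the lattice forces r to be an integer: the lattice is closed
    under intersections. Conversely, if p and p + 1 are constructed, so are the
    pairs translated by any +X_i or -X_i.

    (ii) To leave a subspace V containing every point constructed so far, one
    must use two distinct angles a, b outside V with a and b dependent modulo V.
    Replacing V by V + <a>, which contains b, and starting from the line through
    1, one gets n-1 disjoint pairs of angles before exhausting the space. *)
Require Import Defs.
From HB Require Import structures.
From mathcomp Require Import all_boot all_order all_algebra.
From mathcomp Require Import all_classical all_reals.
From mathcomp Require Import ring zify.

Set Implicit Arguments.
Unset Strict Implicit.
Unset Printing Implicit Defensive.

Import Order.TTheory GRing.Theory Num.Theory.

Local Open Scope classical_set_scope.
Local Open Scope ring_scope.

(** * Angles, intersection points and integer spans *)

Section Angles.
Variables (R : realType) (n : nat).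
Implicit Types (p q z v : 'rV[R]_n) (a b : angle R n) (U : set (angle R n)).

Lemma dirvec_neq0 a : dirvec a != 0.
Proof. exact: (valP (repr a)). Qed.

Lemma angle_eqP a b : a = b <-> exists c, dirvec a = c *: dirvec b.
Proof.
split=> [->|[c e]]; first by exists 1; rewrite scale1r.
have c0 : c != 0.
  by apply: contraNneq (dirvec_neq0 a) => c0; rewrite e c0 scale0r.
suff : (repr b = repr a %[mod angle R n])%qT by rewrite !reprK.
by apply/eqmodP/asboolP; exists c.
Qed.

(** Two common points differ by a multiple of both directions, so for [a <> b] they coincide; for
    [a = b] any common point can be shifted along the shared direction. *)
Lemma meet_pointP p q a b z :
  meet_point p q a b z <-> [/\ a <> b, line p a z & line q b z].
Proof.
split=> [[[pz qz] zP]|[ab pz qz]].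
  split=> // ab; have /eqP[] := dirvec_neq0 a.
  apply: (addrI z); rewrite addr0; symmetry; apply: zP; split.
    by have [r ->] := pz; exists (r + 1); rewrite scalerDl scale1r addrA.
  by have [r ->] := qz; exists (r + 1); rewrite -ab scalerDl scale1r addrA.
split=> // z' [[r' z'p] [s' z'q]]; have [[r zp] [s zq]] := (pz, qz).
apply/eqP/negPn/negP => zz'; apply: ab; apply/angle_eqP.
have rd : z - z' = (r - r') *: dirvec a.
  by rewrite zp z'p scalerBl opprD addrACA subrr add0r.
have sd : z - z' = (s - s') *: dirvec b.
  by rewrite zq z'q scalerBl opprD addrACA subrr add0r.
have r0 : r - r' != 0.
  by apply: contra_neq zz' => r0; apply/eqP; rewrite -subr_eq0 rd r0 scale0r.
exists ((r - r')^-1 * (s - s')).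
by rewrite -scalerA -sd rd scalerA mulVf // scale1r.
Qed.

(** A point [z] is recovered at the next stage by intersecting two lines through [z] itself, which
    takes two distinct angles. *)
Lemma origami_stage_mono U a b (k l : nat) : U a -> U b -> a <> b ->
  (k <= l)%N -> origami_stage U k `<=` origami_stage U l.
Proof.
move=> Ua Ub ab /subnKC <-; elim: (l - k)%N => [|d IH]; first by rewrite addn0.
apply: (subset_trans IH) => z kz; rewrite addnS; exists z, z, a, b; split=> //.
by apply/meet_pointP; split=> //; exists 0; rewrite scale0r addr0.
Qed.

Lemma origami_meet U p q a b z : U a -> U b -> a <> b ->
  origami U p -> origami U q -> line p a z -> line q b z -> origami U z.
Proof.
move=> Ua Ub ab [k _ kp] [l _ lq] pz qz; exists (maxn k l).+1 => //.
exists p, q, a, b; split=> //; last exact/meet_pointP.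
  by apply: (origami_stage_mono Ua Ub ab) kp; rewrite leq_maxl.
by apply: (origami_stage_mono Ua Ub ab) lq; rewrite leq_maxr.
Qed.

Lemma origami_ind U (L : set 'rV[R]_n) : L 0 -> L (vec1 R n) ->
  (forall p q a b z, L p -> L q -> U a -> U b -> a <> b ->
     line p a z -> line q b z -> L z) ->
  origami U `<=` L.
Proof.
move=> L0 L1 LL z [k _]; elim: k z => [|k IH] z /=; first by case=> ->.
case=> p [q [a [b [/IH Lp /IH Lq Ua Ub /meet_pointP[ab pz qz]]]]].
exact: (LL p q a b).
Qed.

Lemma zspan_tupleP m (X : m.-tuple 'rV[R]_n) v :
  zspan X v <-> exists a : 'I_m -> int, v = \sum_(i < m) X`_i *~ a i.
Proof.
case: X => s /= /eqP sm; case: m / sm; split=> -[a ->]; first by exists a.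
by exists [ffun i => a i]; apply: eq_bigr => i _; rewrite ffunE.
Qed.

Lemma zspan_mem (s : seq 'rV[R]_n) v : v \in s -> zspan s v.
Proof.
move=> /seq_tnthP[i ->]; rewrite -[s]/(tval (in_tuple s)).
apply/zspan_tupleP; exists (fun j => (j == i)%:R).
rewrite (bigD1 i) //= eqxx mulr1z big1 ?addr0 => [|j /negPf ->] //.
by rewrite (tnth_nth 0).
Qed.

Lemma zspan_sub_span (s : seq 'rV[R]_n) v : zspan s v -> v \in <<s>>%VS.
Proof.
move=> [a ->]; apply: memv_suml => i _; rewrite -scaler_int memvZ //.
by rewrite memv_span // mem_nth.
Qed.

(** A full lattice contains a basis. In (i) this gives the freeness of the given generators; in (ii)
    it ensures that proper subspaces are left. *)
Lemma full_lattice_span (L : set 'rV[R]_n) (V : {vspace 'rV[R]_n}) :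
  full_lattice L -> (forall v, L v -> v \in V) -> V = fullv.
Proof.
move=> [b /andP[/eqP bfull _] ->] LV; apply/eqP.
rewrite eqEsubv subvf /= -bfull.
by apply/span_subvP => v /zspan_mem /LV.
Qed.

Lemma mem_zspan_basis (X : n.-tuple 'rV[R]_n) v : free X ->
  zspan X v <-> forall i, coord X i v \is a Num.int.
Proof.
move=> fX; split=> [/zspan_tupleP[a ->] i|cX].
  rewrite linear_sum rpred_sum // => j _.
  by rewrite raddfMz /= coord_free // rpredMz // rpred_nat.
have bX : basis_of fullv X.
  by rewrite basisEfree fX subvf size_tuple dimvf /dim /= mul1n.
apply/zspan_tupleP; exists (fun i => Num.floor (coord X i v)).
rewrite {1}(coord_basis bX (memvf v)); apply: eq_bigr => i _.
by rewrite -scaler_int floorK.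
Qed.

End Angles.

Lemma dirvec_angle_of (R : realType) n (v : 'rV[R]_n) (hv : v != 0) :
  exists2 c, c != 0 & dirvec (angle_of hv) = c *: v.
Proof.
have : same_angle (exist _ v hv) (repr (angle_of hv)).
  by apply/eqmodP; rewrite reprK.
by move=> /asboolP[c c0 e]; exists c.
Qed.

Lemma line_angle_of (R : realType) n (p v : 'rV[R]_n) (hv : v != 0) z :
  line p (angle_of hv) z <-> exists r, z = p + r *: v.
Proof.
have [c c0 e] := dirvec_angle_of hv; rewrite /line /= e.
split=> -[r ->]; first by exists (r * c); rewrite scalerA.
by exists (r / c); rewrite scalerA divfK.
Qed.

(** * Part (i): a lattice as an origami set *)

Section LatticeIsOrigami.
Variables (R : realType) (n : nat) (X : n.+1.-tuple 'rV[R]_n.+1).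
Hypotheses (fX : free X) (X0 : X`_0 = vec1 R n.+1).

(** The index type has exactly 1 + 2n = 2(n + 1) - 1 elements, in ambient dimension n + 1; the
    boolean tells whether [X_0] is subtracted. *)
Definition direction (p : option (bool * 'I_n)) : 'rV[R]_n.+1 :=
  if p is Some (e, i) then X`_(lift ord0 i) - e%:R *: X`_0 else X`_0.

Lemma coord_direction i p : coord X i (direction p) =
  if p is Some (e, j) then (lift ord0 j == i)%:R - e%:R * (ord0 == i)%:R
  else (ord0 == i)%:R.
Proof.
case: p => [[e j]|]; rewrite /direction; last exact: (coord_free ord0).
by rewrite linearB linearZ /= (coord_free ord0) // (coord_free (lift ord0 j)).
Qed.

Lemma direction_neq0 p : direction p != 0.
Proof.
pose i := if p is Some (_, j) then lift ord0 j else ord0.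
apply: contra_neq (oner_neq0 R) => /(congr1 (coord X i)).
rewrite coord_direction linear0 /i => <-.
by case: p {i} => [[e j]|]; rewrite eqxx // eq_liftF mulr0 subr0.
Qed.

Lemma coord_directionB i p q r s :
  coord X i (r *: direction p - s *: direction q) =
  r * coord X i (direction p) - s * coord X i (direction q).
Proof. by rewrite linearB 2!linearZ. Qed.

(* The form coord i + f coord j kills direction q and is 1 or -1 at direction p. *)
Lemma separating_form p q : p != q -> exists (i j : 'I_n.+1) (f b : bool),
  forall r s, let v := r *: direction p - s *: direction q in
  coord X i v + f%:R * coord X j v = (-1) ^+ b * r.
Proof.
case: p q => [[e i]|] [[f j]|] // pq; last first.
- exists ord0, (lift ord0 j), f, false => r s v.
  rewrite {}/v !coord_directionB !coord_direction !eqxx eq_liftF.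
  by rewrite eq_sym eq_liftF; case: f {pq}; rewrite /=; ring.
- exists (lift ord0 i), ord0, false, false => r s v.
  rewrite {}/v !coord_directionB !coord_direction !eqxx eq_liftF.
  by rewrite /=; ring.
(* For equal indices [e] and [f] differ, so coordinate 0 plus [f] times coordinate [i] is f - e = 1
   or -1 at [p]. For distinct indices coordinate [i] alone separates. *)
have [ij|ij] := eqVneq i j.
  rewrite -{}ij in pq *.
  exists ord0, (lift ord0 i), f, e => r s v.
  rewrite {}/v !coord_directionB !coord_direction !eqxx eq_liftF.
  rewrite eq_sym eq_liftF.
  by case: e f pq => -[] pq; rewrite ?eqxx // in pq *; rewrite /=; ring.
exists (lift ord0 i), ord0, false, false => r s v.
rewrite {}/v !coord_directionB !coord_direction !eqxx eq_liftF.
rewrite (inj_eq lift_inj) eq_sym (negPf ij).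
by case: e f {pq} => -[] /=; ring.
Qed.

Definition dir_angle p := angle_of (direction_neq0 p).

(** Equal angles would give a vanishing combination of the two directions with a nonzero coefficient
    [c], which the separating form sends to [c] up to sign. *)
Lemma dir_angle_inj : injective dir_angle.
Proof.
move=> p q epq; apply/eqP/negPn/negP => /separating_form[i [j [f [b]]]].
have [c c0 ep] := dirvec_angle_of (direction_neq0 p).
have [d d0 eq] := dirvec_angle_of (direction_neq0 q).
have : dirvec (dir_angle p) = dirvec (dir_angle q) by rewrite epq.
rewrite ep eq => cd /(_ c d) /=; rewrite cd subrr !linear0 mulr0 addr0 => /eqP.
by rewrite eq_sym mulf_eq0 signr_eq0 (negPf c0).
Qed.

Let dir_angles : set (angle R n.+1) := range dir_angle.

Lemma direction_int p r :
  r \is a Num.int -> forall i, coord X i (r *: direction p) \is a Num.int.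
Proof.
move=> rint i; rewrite linearZ /= coord_direction rpredM //.
by case: p => [[e j]|]; rewrite ?rpredB ?rpredM ?rpred_nat.
Qed.

Lemma origami_sub_zspan : origami dir_angles `<=` zspan X.
Proof.
apply: origami_ind => [||p q a b z].
- by apply/mem_zspan_basis => // i; rewrite linear0 rpred0.
- by rewrite -X0; apply: zspan_mem; rewrite mem_nth ?size_tuple.
move=> /(mem_zspan_basis _ fX) Lp /(mem_zspan_basis _ fX) Lq.
move=> [d1 _ <-] [d2 _ <-].
move=> ab /line_angle_of[r zp] /line_angle_of[s zq].
have /separating_form[i [j [f [e phi]]]] : d1 != d2.
  by apply: contra_not_neq ab => ->.
apply/mem_zspan_basis => // k; rewrite zp linearD rpredD //; first exact: Lp.
(* The combination in [phi] is the difference [q - p] of two lattice points, so the form, being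
   integral, shows that [r] is an integer. *)
apply: direction_int; have := phi r s.
have -> : r *: direction d1 - s *: direction d2 = q - p.
  apply/eqP; rewrite subr_eq addrAC eq_sym subr_eq -zq addrC -zp //.
rewrite /= => eqr; rewrite -(signrMK e r) -eqr.
have Lqp l : coord X l (q - p) \is a Num.int.
  by rewrite linearB rpredB; [|exact: Lq|exact: Lp].
by rewrite rpredMsign rpredD // rpredM // rpred_nat.
Qed.

(** Distinct lines through a single point meet only there, so what gets translated through the
    lattice is a pair of points. *)
Let adjacent p := origami dir_angles p /\ origami dir_angles (p + X`_0).

(** In the triangular grid with edge directions [X_0], [x] and [x - X_0], each of the points [M1] to
    [M6] is the third vertex of a triangle on two points already constructed. *)
Lemma adjacent_step (i : 'I_n) p : adjacent p ->
  [/\ adjacent (p + X`_(lift ord0 i)), adjacent (p - X`_(lift ord0 i)),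
      adjacent (p + X`_0) & adjacent (p - X`_0)].
Proof.
set x := X`_(lift ord0 i) => -[Mp Mp1].
have meet p' q' d1 d2 r s z : origami dir_angles p' -> origami dir_angles q' ->
    d1 != d2 -> z = p' + r *: direction d1 -> z = q' + s *: direction d2 ->
    origami dir_angles z.
  move=> Mp' Mq' d12 zp zq.
  apply: (@origami_meet _ _ _ p' q' (dir_angle d1) (dir_angle d2)) => //.
  - by exists d1.
  - by exists d2.
  - by move/dir_angle_inj/eqP; rewrite (negPf d12).
  - by apply/line_angle_of; exists r.
  - by apply/line_angle_of; exists s.
pose t := Some (false, i); pose t' := Some (true, i).
have [Et Et'] : direction t = x /\ direction t' = x - X`_0.
  by rewrite /direction /= scale0r subr0 scale1r.
have E : direction None = X`_0 by [].
have M1 : origami dir_angles (p + x).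
  apply: (meet p (p + X`_0) t t' 1 1) => //;
    by rewrite ?E ?Et ?Et'; apply/rowP=> j; rewrite !mxE; ring.
have M2 : origami dir_angles (p + x + X`_0).
  apply: (meet (p + X`_0) (p + x) t None 1 1) => //;
    by rewrite ?E ?Et ?Et'; apply/rowP=> j; rewrite !mxE; ring.
have M3 : origami dir_angles (p - x + X`_0).
  apply: (meet p (p + X`_0) t' t (-1) (-1)) => //;
    by rewrite ?E ?Et ?Et'; apply/rowP=> j; rewrite !mxE; ring.
have M4 : origami dir_angles (p - x).
  apply: (meet p (p - x + X`_0) t None (-1) (-1)) => //;
    by rewrite ?E ?Et ?Et'; apply/rowP=> j; rewrite !mxE; ring.
have M5 : origami dir_angles (p + X`_0 + X`_0).
  apply: (meet (p + X`_0) (p + x + X`_0) None t' 1 (-1)) => //;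
    by rewrite ?E ?Et ?Et'; apply/rowP=> j; rewrite !mxE; ring.
have M6 : origami dir_angles (p - X`_0).
  apply: (meet p (p - x) None t' (-1) 1) => //;
    by rewrite ?E ?Et ?Et'; apply/rowP=> j; rewrite !mxE; ring.
by split; split=> //; rewrite subrK.
Qed.

Lemma zspan_sub_origami : (0 < n)%N -> zspan X `<=` origami dir_angles.
Proof.
(* Even a step along [X_0] goes through a triangle with some other [X_i]; [i0] supplies one. *)
move=> n0 v /zspan_tupleP[a ->]; pose i0 := Ordinal n0.
have stepZ (i : 'I_n.+1) p (m : int) : adjacent p -> adjacent (p + X`_i *~ m).
  have step s : adjacent s -> adjacent (s + X`_i) /\ adjacent (s - X`_i).
    case: (unliftP ord0 i) => [j|] ->.
      by case/(adjacent_step j).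
    by case/(adjacent_step i0).
  move=> ap; elim/int_rect: m => [|m /step[IH _]|m /step[_ IH]].
  - by rewrite mulr0z addr0.
  - by rewrite intS (addrC 1) mulrzDr mulr1z addrA.
  - by rewrite intS (addrC 1) opprD mulrzDr mulrN1z addrA.
have sum_adjacent (r : seq 'I_n.+1) p :
    adjacent p -> adjacent (p + \sum_(i <- r) X`_i *~ a i).
  elim: r p => [|i r IH] p ap; first by rewrite big_nil addr0.
  by rewrite big_cons addrA; apply/IH/stepZ.
(* The starting pair is 0 and 1, since [X_0] is 1. *)
have [] // := sum_adjacent (index_enum _) 0; last by rewrite add0r.
by rewrite /adjacent add0r X0; split; exists 0%N => //; [left|right].
Qed.

End LatticeIsOrigami.

Lemma zspan_origami (R : realType) (n : nat) (hn : (2 <= n)%N)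
    (X : n.-tuple 'rV[R]_n) :
  free X -> X`_0 = vec1 R n ->
  exists alpha : (2 * n - 1).-tuple (angle R n),
    [/\ uniq alpha, angle1 R hn \in alpha & zspan X = origami [set` alpha]].
Proof.
case: n hn X => // n hn X fX X0.
pose s := map (dir_angle fX) (enum {: option (bool * 'I_n)}).
have ss : size s == (2 * n.+1 - 1)%N.
  by rewrite size_map -cardE card_option card_prod card_bool card_ord; lia.
exists (Tuple ss); have -> : [set` Tuple ss] = range (dir_angle fX).
  apply/seteqP; split=> a /=; first by case/mapP=> d _ ->; exists d.
  by case=> d _ <-; apply: map_f; rewrite mem_enum.
split.
- by rewrite map_inj_uniq ?enum_uniq //; apply: dir_angle_inj.
- apply/mapP; exists None; first by rewrite mem_enum.
  apply/angle_eqP.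
  have [c c0 ->] := dirvec_angle_of (direction_neq0 fX None).
  have [d d0 ->] := dirvec_angle_of (vec1_neq0 R hn).
  by exists (d / c); rewrite scalerA divfK // /direction X0.
- apply/seteqP; split; last exact: origami_sub_zspan.
  exact: zspan_sub_origami.
Qed.

(** * Part (ii): pairs of angles forced by a full lattice *)

(** If z = p + ra = q + sb is outside [V] while [p] and [q] are inside, then [ra] and [sb] are
    outside [V], and sb = ra + (p - q) makes [b] dependent on [a] modulo [V]. Without such a pair
    [V] would be closed under intersections. *)
Lemma origami_escape (R : realType) n (U : set (angle R n))
    (V : {vspace 'rV[R]_n}) :
  vec1 R n \in V -> ~ (origami U `<=` [set v | v \in V]) ->
  exists a b, [/\ U a /\ U b, a <> b, dirvec a \notin V, dirvec b \notin V
                & dirvec b \in (<[dirvec a]> + V)%VS].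
Proof.
move=> V1; apply: contra_notP => noab.
apply: origami_ind => [|//|p q a b z Vp Vq Ua Ub ab [r zp] [s zq]] /=.
  exact: mem0v.
apply/negPn/negP => zV; apply: noab; exists a, b.
have ra : r *: dirvec a \notin V.
  by apply: contra zV => ra; rewrite zp memvD.
have sb : s *: dirvec b \notin V.
  by apply: contra zV => sb; rewrite zq memvD.
split=> //; [by apply: contra ra; apply: memvZ| |].
  by apply: contra sb; apply: memvZ.
have s0 : s != 0 by apply: contraNneq sb => ->; rewrite scale0r mem0v.
have -> : dirvec b = s^-1 *: (r *: dirvec a + (p - q)).
  by rewrite addrCA addrA -zp zq addrC addKr scalerA mulVf // scale1r.
by rewrite memvZ // memv_add ?memvZ ?memv_line // memvB.
Qed.

(** The last clause strengthens the induction: all angles chosen so far lie in the span [V] of 1 and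
    [s], so a pair outside [V] is automatically new. *)
Lemma origami_angle_pairs (R : realType) n (hn : (2 <= n)%N)
    (U : set (angle R n)) k :
  U (angle1 R hn) -> full_lattice (origami U) -> (k < n)%N ->
  exists s s' : seq (angle R n),
    [/\ size s = k /\ size s' = k, [set` angle1 R hn :: s ++ s'] `<=` U,
        uniq (angle1 R hn :: s ++ s'), free (vec1 R n :: map (@dirvec R n) s)
      & forall a, a \in angle1 R hn :: s ++ s' ->
          dirvec a \in <<vec1 R n :: map (@dirvec R n) s>>%VS].
Proof.
move=> U1 UL; elim: k => [_|k IH kn].
  exists [::], [::]; split=> //=; first by move=> a /=; rewrite inE => /eqP ->.
    by rewrite seq1_free vec1_neq0.
  move=> a; rewrite inE => /eqP ->; rewrite span_seq1.
  have [c _ ->] := dirvec_angle_of (vec1_neq0 R hn).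
  by rewrite memvZ // memv_line.
have [s [s' [[sk sk'] sU us fs sV]]] := IH (ltnW kn).
set V := <<_>>%VS in sV.
have V1 : vec1 R n \in V by rewrite memv_span // mem_head.
have [LV|/(origami_escape V1)[a [b [[Ua Ub] ab aV bV baV]]]] :=
  pselect (origami U `<=` [set v | v \in V]).
  (* [V] is spanned by k + 1 < n vectors, so it cannot contain a full lattice. *)
  have VT := full_lattice_span UL LV.
  have := dim_span (vec1 R n :: map (@dirvec R n) s).
  rewrite -/V VT dimvf /dim /= mul1n size_map sk; lia.
(* [a] enlarges the span; [b] then lies in the enlarged span, by its dependence on [a] modulo
   [V]. *)
exists (a :: s), (b :: s').
have perm2 (T : eqType) (x y z : T) t t' :
    perm_eq (x :: (y :: t) ++ z :: t') (y :: z :: x :: t ++ t').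
  by apply/permP => P; rewrite /= !count_cat /=; lia.
have spE : (<<vec1 R n :: map (@dirvec R n) (a :: s)>> = <[dirvec a]> + V)%VS.
  rewrite -span_cons; apply: eq_span => v; rewrite /= !inE orbCA //.
split.
- by rewrite /= sk sk'.
- move=> c /=; rewrite (perm_mem (perm2 _ _ _ _ _ _)) 2!inE.
  by case/or3P=> [/eqP->|/eqP->|/sU].
- rewrite (perm_uniq (perm2 _ _ _ _ _ _)) (cons_uniq a) (cons_uniq b).
  rewrite inE negb_or us andbT -andbA; apply/and3P; split; first exact/eqP.
    by apply: contra aV; apply: sV.
  by apply: contra bV; apply: sV.
- rewrite (@perm_free _ _ _ (dirvec a :: vec1 R n :: map (@dirvec R n) s)).
    by rewrite free_cons aV.
  by apply/permP => P /=; lia.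
- move=> c; rewrite (perm_mem (perm2 _ _ _ _ _ _)) spE 2!inE.
  case/or3P=> [/eqP->|/eqP->//|/sV cV].
    by rewrite (subvP (addvSl _ _)) // memv_line.
  by rewrite (subvP (addvSr _ _)).
Qed.

Theorem theorem1p7 (R : realType) (n : nat) (hn : (2 <= n)%N) :
  (forall tau : (n.-1).-tuple 'rV[R]_n,
     full_lattice (zspan (vec1 R n :: tau)) ->
     exists (m : nat) (alpha : m.-tuple (angle R n)),
       [/\ (2 * n - 1 <= m)%N,
           uniq alpha,
           angle1 R hn \in alpha
         & zspan (vec1 R n :: tau) = origami [set` alpha]])
  /\
  (forall U : set (angle R n),
     U (angle1 R hn) ->
     full_lattice (origami U) ->
     exists alpha alpha' : (n.-1).-tuple (angle R n),
       [/\ [set` angle1 R hn :: alpha ++ alpha'] `<=` U,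
           uniq (angle1 R hn :: alpha ++ alpha')
         & free (vec1 R n :: map (@dirvec R n) alpha)]).

Proof.
split=> [tau tauL|U U1 UL].
  have m1n : ((n.-1).+1 == n)%N by rewrite prednK // ltnW.
  (* These n vectors span a space of dimension n, hence are independent. *)
  have ftau : free (vec1 R n :: tau).
    have spanT := full_lattice_span tauL (@zspan_sub_span _ _ _).
    by rewrite /free spanT dimvf /dim /= mul1n size_tuple eq_sym.
  have st : size (vec1 R n :: tau) == n by rewrite /= size_tuple.
  have [alpha [ua a1 E]] := zspan_origami hn (X := Tuple st) ftau erefl.
  by exists (2 * n - 1)%N, alpha.
(* The pairs are collected up to k = n - 1, where 1 and the first angles of the pairs span the whole
   space. *)
have n1n : (n.-1 < n)%N by rewrite prednK // ltnW.
have [s [s' [[/eqP sk /eqP sk'] sU us fs _]]] := origami_angle_pairs U1 UL n1n.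
by exists (Tuple sk), (Tuple sk').
Qed.
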